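(* If $S_k\subseteq\mathbb{R}_+$ ($k=1,2,\dots$) are sets with the Baire property that are essentially unbounded in the category sense, then for quasi all $\eta\in\mathbb{R}_+$ and each $k\in\mathbb{N}$ there exists an unbounded subset $\mathbb{J}^k_\eta$ of $\mathbb{N}$ with $$\{n\eta : n\in\mathbb{J}^k_\eta\}\subset S_k .$$ In particular this is so if the sets $S_k$ are open (and essentially unbounded).
   Context: $\mathbb{R}_+=(0,\infty)$ with the Euclidean topology. A set $S$ with the Baire property is essentially unbounded in the category sense if for each $m\in\mathbb{N}$ the set $S\setminus(-m,m)$ is non-meagre. ''Quasi all'' means all except for a meagre set. *)

(* Defs.v *)
(* The real line is an arbitrary [R : realType]. *)
From HB Require Import structures.
From mathcomp Require Import all_boot all_order all_algebra.
From mathcomp Require Import all_classical all_reals all_analysis.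

Set Implicit Arguments.
Unset Strict Implicit.
Unset Printing Implicit Defensive.

Import Order.TTheory GRing.Theory Num.Theory.
Import numFieldNormedType.Exports.

Local Open Scope classical_set_scope.
Local Open Scope ring_scope.

Section BaireCategory.
Context {T : topologicalType}.

Definition nowhere_dense (A : set T) : Prop := (closure A)° = set0.

Definition meagre (A : set T) : Prop :=
  exists F : nat -> set T,
    (forall i, nowhere_dense (F i)) /\ A = \bigcup_i F i.

Definition baire_property (A : set T) : Prop :=
  exists U M : set T, [/\ open U, meagre M & A = U `+` M].

Definition quasi_all (P : T -> Prop) : Prop := meagre [set x | ~ P x].

End BaireCategory.

(* [set_type] carries the topology induced from [R], so [open] and [meagre]
   for subsets of [Rplus R] are relative to (0, +oo). *)
Definition Rplus (R : realType) : topologicalType :=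
  set_type [set x : R | 0 < x].

Definition to_real (R : realType) (x : Rplus R) : R := set_val x.

Definition ess_unbounded (R : realType) (S : set (Rplus R)) : Prop :=
  forall m : nat, ~ meagre (S `\` [set x | - m%:R < to_real x < m%:R]).

(* The inclusion is stated in [R] because [n%:R * to_real eta] has type [R];
   it forces [0 \notin J], so it is immaterial whether 0 counts as a natural. *)
Definition multiples_in (R : realType) (S : set (Rplus R)) (eta : Rplus R)
    (J : set nat) : Prop :=
  [set n%:R * to_real eta | n in J] `<=` @to_real R @` S.

(* Main.v *)
Require Import Defs.
From HB Require Import structures.
From mathcomp Require Import all_boot all_order all_algebra.
From mathcomp Require Import all_classical all_reals all_analysis.
From mathcomp Require Import lra.

Set Implicit Arguments.
Unset Strict Implicit.
Unset Printing Implicit Defensive.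

Import Order.TTheory GRing.Theory Num.Theory.
Import numFieldNormedType.Exports.

Local Open Scope classical_set_scope.
Local Open Scope ring_scope.

(** Write [S k] as [U k `+` M k] with [U k] open and [M k] meagre. Since the
    part of [S k] beyond any bound is non-meagre, [U k] is unbounded.

    Fix [k] and [m]. The open set of those [eta] with [n * eta] in [U k] for
    some [n > m] is dense: a nonempty interval [(a, b)] has dilates
    [(n * a, n * b)], [n > m], which overlap once [n] is large and so cover a
    neighbourhood of +oo, hence meet [U k] ([ex_dilate], [nowhere_dense_misses]).
    Its complement is therefore nowhere dense. Dilation by [n > 0] is a
    homeomorphism of (0, +oo), so the set of [eta] with [n * eta] in [M k] is
    meagre ([meagre_preimage]). Discarding these countably many meagre sets
    leaves [eta] such that, for every [k] and [m], some [n > m] satisfies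
    [n * eta \in U k `\` M k], a subset of [S k]. *)

(** * Meagre sets in a topological space *)

Section Meagre.
Context {T : topologicalType}.

Lemma nowhere_dense_sub (A B : set T) :
  A `<=` B -> nowhere_dense B -> nowhere_dense A.
Proof.
move=> AB; rewrite /nowhere_dense -!subset0; apply: subset_trans.
exact/interiorS/closureS.
Qed.

Lemma meagre_sub (A B : set T) : A `<=` B -> meagre B -> meagre A.
Proof.
move=> AB [F [ndF BF]]; exists (fun i => F i `&` A); split => [i|].
  exact: nowhere_dense_sub (@subIsetl _ _ _) (ndF i).
by rewrite -setI_bigcupl -BF setIidr.
Qed.

Lemma nowhere_dense_meagre (A : set T) : nowhere_dense A -> meagre A.
Proof.
move=> ndA; exists (fun=> A); split => //.
by rewrite bigcup_const //; exists 0%N.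
Qed.

Lemma nowhere_dense0 : nowhere_dense (@set0 T).
Proof. by rewrite /nowhere_dense closure0 interior0. Qed.

Lemma meagre_bigcup (I : countType) (A : I -> set T) :
  (forall i, meagre (A i)) -> meagre (\bigcup_i A i).
Proof.
move=> /choice[F FA].
(* One sequence has to run through the double family [F i j]; indices that
   code no pair contribute the empty set. *)
pose G n := if @unpickle (I * nat)%type n is Some p then F p.1 p.2 else set0.
exists G; split => [n|].
  rewrite /G; case: unpickle => [p|]; last exact: nowhere_dense0.
  exact: (FA p.1).1.
rewrite eqEsubset; split => x [n _].
  rewrite (FA n).2 => -[j _ Fx].
  by exists (pickle (n, j)) => //; rewrite /G pickleK.
rewrite /G; case: unpickle => [p Fx|//].
by exists p.1 => //; rewrite (FA p.1).2; exists p.2.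
Qed.

Lemma meagreU (A B : set T) : meagre A -> meagre B -> meagre (A `|` B).
Proof.
move=> mA mB; apply: (@meagre_sub _ (\bigcup_(b : bool) if b then A else B)).
  by move=> x [Ax|Bx]; [exists true|exists false].
by apply: meagre_bigcup => -[].
Qed.

Lemma open_baire_property (U : set T) : open U -> baire_property U.
Proof.
move=> oU; exists U, set0; split => //; last by rewrite setY0.
exact/nowhere_dense_meagre/nowhere_dense0.
Qed.

End Meagre.

(** Being a homeomorphism, [f] carries the interior of the closure of the
    preimage to an open set contained in the closure of [B]. *)
Lemma nowhere_dense_preimage (T T' : topologicalType) (f : T -> T')
    (g : T' -> T) (B : set T') :
  cancel f g -> cancel g f -> continuous f -> continuous g ->
  nowhere_dense B -> nowhere_dense (f @^-1` B).
Proof.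
move=> fK gK /continuousP cf /continuousP cg; rewrite /nowhere_dense -!subset0.
move=> ndB x clx; apply: (ndB (f x)).
rewrite /interior nbhsE; exists (g @^-1` (closure (f @^-1` B))°).
  by split; [exact/cg/open_interior|rewrite /preimage/= fK].
move=> y /interior_subset cly.
suff : (f @^-1` closure B) (g y) by rewrite /preimage/= gK.
have : closed (f @^-1` closure B).
  by rewrite -openC preimage_setC; apply/cf/closed_openC/closed_closure.
rewrite closure_id => ->; apply: closureS cly.
by apply: preimage_subset; exact: subset_closure.
Qed.

Lemma meagre_preimage (T T' : topologicalType) (f : T -> T')
    (g : T' -> T) (B : set T') :
  cancel f g -> cancel g f -> continuous f -> continuous g ->
  meagre B -> meagre (f @^-1` B).
Proof.
move=> fK gK cf cg [F [ndF ->]]; exists (fun i => f @^-1` F i).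
split; last by rewrite preimage_bigcup.
by move=> i; apply: nowhere_dense_preimage gK _ _ _.
Qed.

(** * Dilations of the half-line *)

Section Dilation.
Variable R : realType.
Implicit Types (x y eta : Rplus R) (U C : set (Rplus R)).

Lemma to_real_gt0 x : 0 < to_real x.
Proof. by have := set_valP x. Qed.

Lemma to_real_inj : injective (@to_real R).
Proof. exact: val_inj. Qed.

Definition pos_real (a : R) (a0 : 0 < a) : Rplus R :=
  @SigSub _ _ [set x : R | 0 < x] a (mem_set (a0 : [set x : R | 0 < x] a)).

Lemma pos_realK (a : R) (a0 : 0 < a) : to_real (pos_real a0) = a.
Proof. by []. Qed.

Lemma continuous_to_real : continuous (@to_real R).
Proof. exact: initial_continuous. Qed.

Lemma dilate_gt0 (c : R) (c0 : 0 < c) x : 0 < c * to_real x.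
Proof. exact: mulr_gt0 c0 (to_real_gt0 x). Qed.

Definition dilate (c : R) (c0 : 0 < c) x : Rplus R := pos_real (dilate_gt0 c0 x).

Lemma dilateK (c d : R) (c0 : 0 < c) (d0 : 0 < d) :
  d * c = 1 -> cancel (dilate c0) (dilate d0).
Proof. by move=> dc1 x; apply: to_real_inj; rewrite !pos_realK mulrA dc1 mul1r. Qed.

Lemma continuous_dilate (c : R) (c0 : 0 < c) : continuous (dilate c0).
Proof.
apply: (@continuous_comp_initial _ _ _ set_val) => x.
apply: (@continuous_comp _ _ _ (@to_real R) ( *%R c)).
  exact: continuous_to_real.
exact: mulrl_continuous.
Qed.

Lemma meagre_dilate (c : R) (c0 : 0 < c) (M : set (Rplus R)) :
  meagre M -> meagre (dilate c0 @^-1` M).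
Proof.
have ic0 : 0 < c^-1 by rewrite invr_gt0.
apply: (@meagre_preimage _ _ _ (dilate ic0)); last 2 first.
- exact: continuous_dilate.
- exact: continuous_dilate.
- by apply: dilateK; rewrite mulVf ?gt_eqF.
- by apply: dilateK; rewrite mulfV ?gt_eqF.
Qed.

(** The multiple [n.+1 * eta]: the index is shifted because [0 * eta] leaves
    (0, +oo). *)
Definition dilateS (n : nat) : Rplus R -> Rplus R := dilate (ltr0Sn R n).

(** The intervals [(n * a, n * b)] and [((n+1) * a, (n+1) * b)] overlap as soon
    as [n * (b - a) > a], so the dilates of [(a, b)] cover everything beyond
    [a * b / (b - a)]. The other lower bound on [x] forces the dilation factor
    to be large. *)
Lemma ex_dilate (m : nat) (a b x : R) : 0 < a -> a < b ->
  m.+1%:R * b < x -> a * b / (b - a) < x ->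
  exists2 n, (m <= n)%N & n.+1%:R * a < x < n.+1%:R * b.
Proof.
move=> a0 ab mx abx; have b0 := lt_trans a0 ab.
have x0 : 0 < x by apply: le_lt_trans mx; rewrite mulr_ge0 // ltW.
have /andP[lo hi] := truncn_itv (ltW (divr_gt0 x0 b0)).
(* [n.+1] is the least integer exceeding [x / b]. *)
exists (Num.truncn (x / b)).
  rewrite truncn_ge_nat ?(ltW (divr_gt0 x0 b0)) // ler_pdivlMr //.
  apply: le_trans (ltW mx); rewrite ler_pM2r // ler_nat; exact: leqnSn.
move: hi; rewrite ltr_pdivrMr // => ->; rewrite andbT.
move: lo; rewrite ler_pdivlMr // => lo.
move: abx; rewrite ltr_pdivrMr ?subr_gt0 // => abx.
rewrite -(ltr_pM2r b0) -natr1; nra.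
Qed.

Definition unbounded_above U := forall c : R, exists2 x, U x & c < to_real x.

Definition misses U (m : nat) : set (Rplus R) :=
  [set eta | forall n, (m <= n)%N -> ~ U (dilateS n eta)].

(** [misses U m] is closed, and no interval [(a, b)] lies in it: by
    [ex_dilate] a large enough point of [U] lies in a dilate of [(a, b)]. *)
Lemma nowhere_dense_misses U m :
  open U -> unbounded_above U -> nowhere_dense (misses U m).
Proof.
move=> oU unbU.
have clm : closed (misses U m).
  have -> : misses U m =
      ~` \bigcup_(n in [set n | (m <= n)%N]) (dilateS n @^-1` U).
    by rewrite setC_bigcup.
  apply/open_closedC/bigcup_open => n _.
  by move/continuousP: (@continuous_dilate _ (ltr0Sn R n)); apply.
rewrite /nowhere_dense -(closure_id _).1 // -subset0 => x.
rewrite /interior/= => -[_ [[B oB <-] Bx] Bm].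
have /nbhs_ballP[e /= e0 eB] : nbhs (to_real x) B by exact: open_nbhs_nbhs.
set a := to_real x; set b := a + e.
have a0 : 0 < a := to_real_gt0 x.
have ab : a < b by rewrite ltrDl.
have [y Uy] := unbU (Num.max (m.+1%:R * b) (a * b / (b - a))).
rewrite gt_max => /andP[y1 y2].
have [n mn /andP[ny1 ny2]] := ex_dilate a0 ab y1 y2.
have n0 := ltr0Sn R n.
have in0 : 0 < n.+1%:R^-1 :> R by rewrite invr_gt0.
pose eta := dilate in0 y.
have etaE : dilateS n eta = y by apply: dilateK; rewrite mulfV ?gt_eqF.
(* The contradiction comes from [y / n.+1], which lies within [e] of [x] and
   has its [n.+1]-fold multiple [y] in [U]. *)
apply: (Bm eta _ n mn); last by rewrite etaE.
apply: eB; rewrite /ball/= ltr_distlC.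
have -> : set_val eta = to_real y / n.+1%:R by rewrite mulrC.
have lo : a < to_real y / n.+1%:R by rewrite ltr_pdivlMr // mulrC.
have hi : to_real y / n.+1%:R < b by rewrite ltr_pdivrMr // mulrC.
by rewrite -/a hi andbT (lt_trans _ lo) // ltrBlDr ltrDl.
Qed.

(** Beyond an upper bound of [U], every point of [S] would lie in [M]. *)
Lemma ess_unbounded_open_part (S U M : set (Rplus R)) :
  meagre M -> S = U `+` M -> ess_unbounded S -> unbounded_above U.
Proof.
move=> mM SE eS c; apply: contrapT => nU.
pose m := (Num.truncn c).+1.
apply: (eS m); apply: meagre_sub mM => x [].
rewrite SE => -[[Ux _]|[] //] /= nx; exfalso.
apply: nU; exists x => //; rewrite ltNge; apply/negP => xc; apply: nx.
rewrite (le_lt_trans xc (truncnS_gt c)) andbT.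
by rewrite (lt_trans _ (to_real_gt0 x)) // oppr_lt0.
Qed.

Lemma quasi_all_multiples (S : nat -> set (Rplus R)) :
  (forall k, baire_property (S k)) -> (forall k, ess_unbounded (S k)) ->
  quasi_all (fun eta => forall k, exists J : set nat,
    ~ has_ubound J /\ multiples_in (S k) eta J).
Proof.
move=> /choice[U /choice[M UM]] eS.
apply: (@meagre_sub _ _ (\bigcup_k ((\bigcup_m misses (U k) m) `|`
                                    (\bigcup_n (dilateS n @^-1` M k))))); last first.
  apply: meagre_bigcup => k; have [oU mM SE] := UM k.
  apply: meagreU; apply: meagre_bigcup => n; last exact: meagre_dilate.
  apply/nowhere_dense_meagre/nowhere_dense_misses => //.
  exact: ess_unbounded_open_part mM SE (eS k).
move=> eta /=; apply: contra_notP => good k.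
have [_ _ SE] := UM k.
exists [set n.+1 | n in [set n | U k (dilateS n eta)]]; split.
  move=> [m Jm]; apply: good; exists k => //; left; exists m => // n mn Un.
  by have := Jm n.+1 (ex_intro2 _ _ n Un erefl); rewrite leEnat leqNgt ltnS mn.
move=> _ [_ [n /= Un <-] <-]; exists (dilateS n eta) => //.
rewrite SE; left; split => // Mn.
by apply: good; exists k => //; right; exists n.
Qed.

End Dilation.

Theorem theorem3 (R : realType) :
  (forall S : nat -> set (Rplus R),
     (forall k, baire_property (S k)) ->
     (forall k, ess_unbounded (S k)) ->
     quasi_all (fun eta : Rplus R => forall k : nat,
       exists J : set nat, ~ has_ubound J /\ multiples_in (S k) eta J))
  /\
  (forall S : nat -> set (Rplus R),
     (forall k, open (S k)) ->
     (forall k, ess_unbounded (S k)) ->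
     quasi_all (fun eta : Rplus R => forall k : nat,
       exists J : set nat, ~ has_ubound J /\ multiples_in (S k) eta J)).
Proof.
split=> S; first exact: quasi_all_multiples.
by move=> oS; apply: quasi_all_multiples => k; apply: open_baire_property.
Qed.
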